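(* Let $\mu$ be a monotone measure on $(X,\mathcal{B})$ which is continuous at $\emptyset$ and continuous from below. Let $\{f_n\}_{n\in\mathbb{N}}$ be an increasing sequence of measurable functions on $X$ converging pointwise to $f$. Let $\mathcal{S}=\mathcal{S}^{P\pm}$ or $\mathcal{S}=\mathcal{S}^{P\pm}_\mu$, and assume that $\int^{\uparrow}_{\mathcal{S}} f_1\,d\mu>-\infty$ and $\int^{\uparrow}_{\mathcal{S}} 1_X\,d\mu<\infty$. Then $$\lim_{n\to\infty}\int^{\uparrow}_{\mathcal{S}} f_n\,d\mu=\int^{\uparrow}_{\mathcal{S}} f\,d\mu .$$
   Context: $(X,\mathcal{B})$ is a measurable space ($\mathcal{B}$ a $\sigma$-algebra on $X$). Measurable functions (including the limit $f$) are real-valued. $1_A$ is the indicator function of $A$. A monotone measure is a set function $\mu:\mathcal{B}\to[0,\infty)$ with $\mu(\emptyset)=0$ and $\mu(A)\le\mu(B)$ whenever $A\subset B$; throughout, every monotone measure is assumed to be continuous from above and below, i.e. $A_n\nearrow A$ or $A_n\searrow A$ implies $\mu(A_n)\to\mu(A)$. Continuity from below is the case $A_n\nearrow A$; continuity at $\emptyset$ means $A_n\searrow\emptyset$ implies $\mu(A_n)\to 0$. No additivity is assumed. A simple function is a finite or infinite sequence of pairs $\varphi=\{(a_k,A_k)\}_k$ with $a_k\in\mathbb{R}$, $A_k\in\mathcal{B}$; it is identified with the function $\varphi(x)=\sum_k a_k 1_{A_k}(x)$, but its basic sum $\mu(\varphi)=\sum_k a_k\mu(A_k)$ depends on the sequence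 of pairs. A partition of $X$ is a family of pairwise disjoint sets in $\mathcal{B}$ (possibly empty) with union $X$. The classes are: - $\mathcal{S}^{P\pm}$: all finite sequences $\{(a_k,A_k)\}_{k=1}^n$, $n\in\mathbb{N}$, with $a_k\in\mathbb{R}$ and $\{A_k\}_k$ a partition of $X$; - $\mathcal{S}^{P\pm}_\mu$: all infinite sequences $\{(a_k,A_k)\}_{k=1}^\infty$ with $a_k\in\mathbb{R}$, $\sum_k |a_k|\mu(A_k)<\infty$ and $\{A_k\}_k$ a partition of $X$. For a class $\mathcal{S}$ and a measurable function $f$, $L(\mathcal{S},f)=\{\varphi\in\mathcal{S}:\varphi(x)\le f(x)\ \forall x\in X\}$ and $\int^{\uparrow}_{\mathcal{S}} f\,d\mu=\sup\{\mu(\varphi):\varphi\in L(\mathcal{S},f)\}$, taken in the extended reals with $\sup\emptyset=-\infty$ (the value $+\infty$ is allowed). *)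

(* Defs.v *)
From mathcomp Require Import all_boot all_order all_algebra.
From mathcomp Require Import all_classical all_reals all_analysis.
Import Order.TTheory GRing.Theory Num.Theory numFieldNormedType.Exports.

Set Implicit Arguments.
Unset Strict Implicit.
Unset Printing Implicit Defensive.

Local Open Scope classical_set_scope.
Local Open Scope ring_scope.

Section MonotoneMeasure.
Context (R : realType) (d : measure_display) (X : measurableType d).
Implicit Types (mu : set X -> R) (A : (set X)^nat).

(* Only the values of [mu] on measurable sets are constrained or used. No
   continuity is built in. *)
Definition monotone_measure mu : Prop :=
  [/\ mu set0 = 0,
      forall B, measurable B -> 0 <= mu B &
      forall B C, measurable B -> measurable C -> B `<=` C -> mu B <= mu C].

Definition continuous_from_below mu : Prop :=
  forall A, (forall n, measurable (A n)) ->
    (forall n, A n `<=` A n.+1) ->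
    mu (A n) @[n --> \oo] --> mu (\bigcup_n A n).

Definition continuous_at_empty mu : Prop :=
  forall A, (forall n, measurable (A n)) ->
    (forall n, A n.+1 `<=` A n) -> \bigcap_n A n = set0 ->
    mu (A n) @[n --> \oo] --> (0 : R).

End MonotoneMeasure.

Section SimpleFunctions.
Context (R : realType) (d : measure_display) (X : measurableType d).

(* Simple functions are kept as sequences of pairs rather than as functions,
   because the basic sum depends on the sequence. *)
Inductive simple : Type :=
| FinSimple n of 'I_n -> R * set X
| InfSimple of nat -> R * set X.

(* For infinite sequences, [simple_val] and [basic_sum] are limits of partial
   sums in [R]; these limits exist for the members of [SPmu] below. *)
Definition simple_val (phi : simple) (x : X) : R :=
  match phi with
  | FinSimple n s => \sum_(k < n) (s k).1 * \1_(s k).2 x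
  | InfSimple s => limn (series (fun k => (s k).1 * \1_(s k).2 x))
  end.

Definition basic_sum (mu : set X -> R) (phi : simple) : R :=
  match phi with
  | FinSimple n s => \sum_(k < n) (s k).1 * mu (s k).2
  | InfSimple s => limn (series (fun k => (s k).1 * mu (s k).2))
  end.

(* Unlike [classical_sets.partition], the blocks may be empty. *)
Definition measurable_partition (I : Type) (A : I -> set X) : Prop :=
  [/\ forall i, measurable (A i), trivIset setT A & \bigcup_i A i = setT].

Definition SP : set simple := [set phi |
  match phi with
  | FinSimple n s => measurable_partition (fun k => (s k).2)
  | InfSimple _ => False
  end].

Definition SPmu (mu : set X -> R) : set simple := [set phi |
  match phi with
  | FinSimple _ _ => False
  | InfSimple s =>
      (\sum_(0 <= k <oo) (`|(s k).1| * mu (s k).2)%:E < +oo)%E /\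
      measurable_partition (fun k => (s k).2)
  end].

Definition lower_class (S : set simple) (f : X -> R) : set simple :=
  [set phi | S phi /\ forall x, simple_val phi x <= f x].

Definition lower_integral (S : set simple) (mu : set X -> R) (f : X -> R) :
    \bar R :=
  ereal_sup [set (basic_sum mu phi)%:E | phi in lower_class S f].

End SimpleFunctions.

Arguments SP {R d X}.

(* Main.v *)
(** Let [s] be a lower simple function of [f] and [t] one of [fs 0]. Lower each
    value [a_k] of [s] to [c_k < a_k], so little that the basic sum drops by at
    most [e/2]. Since [fs n] increases to [f], the sets
    [E n = {c <= fs n}] increase to the whole space, and the function equal to
    [c] on [E n] and to [t] off [E n] is a lower simple function of [fs n]. As
    [n] grows, continuity from below and at the empty set, together with
    dominated convergence for series, make its basic sum tend to that of [c].
    Finite simple functions are handled as infinite ones whose blocks are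
    eventually empty. *)
Require Import Defs.
From mathcomp Require Import all_boot all_order all_algebra.
From mathcomp Require Import all_classical all_reals all_analysis.
From mathcomp Require Import lra.
Import Order.TTheory GRing.Theory Num.Theory numFieldNormedType.Exports.

Set Implicit Arguments.
Unset Strict Implicit.
Unset Printing Implicit Defensive.

Local Open Scope classical_set_scope.
Local Open Scope ring_scope.

(** * Real series: dominated convergence and interleaving *)

Section RealSeries.
Context {R : realType}.
Implicit Types (u v l M : R^nat) (g : nat -> R^nat).

(** Translates the extended-real condition of [SPmu] into convergence in [R], the form used from
    here on. *)
Lemma nneseries_lty_cvgn_series u : (forall k, 0 <= u k) ->
  (\sum_(0 <= k <oo) (u k)%:E < +oo)%E <-> cvgn (series u).
Proof.
move=> u0; split=> [sumu|cu]; first exact: nnseries_is_cvg.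
rewrite (_ : (fun n => _) = EFin \o series u); last first.
  by apply/funext => n /=; rewrite sumEFin.
by rewrite EFin_lim// ltry.
Qed.

Lemma dominated_cvgn_series u M :
  (forall k, `|u k| <= M k) -> cvgn (series M) -> cvgn (series u).
Proof.
move=> uM cM; apply: normed_cvg; apply: (series_le_cvg _ _ _ cM) => n //=.
exact: le_trans (normr_ge0 _) (uM n).
Qed.

(** For [m >= N] the partial sums of [u] up to [N] and [m] differ by at most the sum of [M] over
    [[N, m)], hence by at most the tail of [M]; then [m] goes to infinity. *)
Lemma dominated_series_tail u M N :
  (forall k, `|u k| <= M k) -> cvgn (series M) ->
  `|limn (series u) - series u N| <= limn (series M) - series M N.
Proof.
move=> uM cM; have cu := dominated_cvgn_series uM cM.
have M0 k : 0 <= M k by exact: le_trans (normr_ge0 _) (uM k).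
have h : (fun m => `|series u m - series u N|) @ \oo -->
    `|limn (series u) - series u N|.
  by apply: cvg_norm; apply: cvgB => //; exact: cvg_cst.
rewrite -(cvg_lim _ h)//; apply: limr_le; first exact: cvgP h.
exists N => // m /= Nm; rewrite sub_series_geq//.
rewrite (le_trans (ler_norm_sum _ _ _))//.
apply: (@le_trans _ _ (\sum_(N <= k < m) M k)); first exact: ler_sum.
rewrite -sub_series_geq// lerB// nondecreasing_cvgn_le//.
exact: nondecreasing_series.
Qed.

(** Tannery's theorem, dominated convergence for series: cut at [N], let the finite sums converge,
    and bound both tails by the tail of [M]. *)
Lemma tannery g l M :
  (forall n k, `|g n k| <= M k) -> cvgn (series M) ->
  (forall k, g n k @[n --> \oo] --> l k) ->
  limn (series (g n)) @[n --> \oo] --> limn (series l).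
Proof.
move=> gM cM gl.
have lM k : `|l k| <= M k.
  have /cvg_norm h := gl k.
  by rewrite -(cvg_lim _ h)//; apply: limr_le; [exact: cvgP h|near=> n].
apply/cvgrPdist_lt => e e0.
have e3 : 0 < e / 3 by rewrite divr_gt0.
(* One [N] serves all [n], because the tail of [M] does not depend on [n]. *)
have [N _ NM] : \forall N \near \oo, `|limn (series M) - series M N| < e / 3.
  by move/cvgrPdist_lt : (cM); exact.
have {NM} : limn (series M) - series M N < e / 3 => [|NM].
  exact: le_lt_trans (ler_norm _) (NM _ (leqnn N)).
have sN : (fun n => series (g n) N) @ \oo --> series l N.
  rewrite /series/=; apply: cvg_big => [|k _].
    exact: add_continuous.
  exact: gl.
have tl := dominated_series_tail N lM cM.
near=> n.
have tg := dominated_series_tail N (gM n) cM.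
have : `|series l N - series (g n) N| < e / 3.
  by near: n; move/cvgrPdist_lt : sN; exact.
move: tl tg NM; rewrite !ler_norml ltr_norml.
move=> /andP[? ?] /andP[? ?] ? /andP[? ?].
by rewrite ltr_norml; apply/andP; split; lra.
Unshelve. all: by end_near. Qed.

(** Merges two infinite sequences into one still indexed by [nat], as [InfSimple] requires. *)
Definition interleave (T : Type) (u v : nat -> T) (k : nat) : T :=
  if odd k then v k./2 else u k./2.

(** Among the indices below [n], [uphalf n] are even and [n./2] are odd. *)
Lemma series_interleave u v n :
  series (interleave u v) n = series u (uphalf n) + series v n./2.
Proof.
elim: n => [|n IHn]; first by rewrite /series/= !big_geq// addr0.
rewrite seriesSr IHn uphalfE /= /interleave uphalf_half.
case: ifPn => _; rewrite /= ?add0n ?add1n !seriesSr; first by rewrite addrA.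
by rewrite addrAC.
Qed.

Lemma cvgn_series_interleave u v : cvgn (series u) -> cvgn (series v) ->
  series (interleave u v) @ \oo --> limn (series u) + limn (series v).
Proof.
move=> cu cv; rewrite (_ : series _ = fun n =>
    (series u \o uphalf) n + (series v \o half) n); last first.
  by apply/funext => n /=; exact: series_interleave.
have half_oo : half @ \oo --> \oo.
  apply/cvgnyPge => A; exists A.*2 => // n /= An.
  by rewrite -(doubleK A) half_leq.
apply: cvgD; last exact: cvg_comp half_oo cv.
apply: cvg_comp cu; apply/cvgnyPge => A; exists A.*2 => // n /= An.
by rewrite uphalfE -(doubleK A) half_leq// (leq_trans An).
Qed.

End RealSeries.

(** * Partitions and the blockwise description of lower classes *)

Section Partitions.
Context {R : realType} {d : measure_display} {X : measurableType d}.
Implicit Types (f : X -> R) (mu : set X -> R) (E : set X).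

(** On a partition this amounts to [simple_val] being at most [f], expressed without sums. *)
Definition below {I : Type} (s : I -> R * set X) f :=
  forall i x, (s i).2 x -> (s i).1 <= f x.

Definition summable_blocks mu (s : nat -> R * set X) :=
  cvgn (series (fun k => `|(s k).1| * mu (s k).2)).

Lemma partition_ex {I : Type} {A : I -> set X} (x : X) :
  measurable_partition A -> exists i, A i x.
Proof.
by move=> [_ _ AT]; have : setT x by []; rewrite -AT => -[i _ Aix]; exists i.
Qed.

Lemma partition_inj {I : Type} {A : I -> set X} {i j : I} {x : X} :
  measurable_partition A -> A i x -> A j x -> i = j.
Proof. by move=> [_ tA _] Ai Aj; apply: tA => //; exists x. Qed.

Lemma partition_term {I : eqType} {s : I -> R * set X} {i j : I} {x : X} :
  measurable_partition (fun k => (s k).2) -> (s i).2 x ->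
  (s j).1 * \1_(s j).2 x = if j == i then (s i).1 else 0.
Proof.
move=> ps six; rewrite indicE; case: eqP => [->|ji].
  by rewrite mem_set ?mulr1.
by rewrite memNset ?mulr0// => sjx; exact/ji/(partition_inj ps sjx six).
Qed.

Lemma simple_val_FinSimple n (s : 'I_n -> R * set X) i x :
  measurable_partition (fun k => (s k).2) -> (s i).2 x ->
  simple_val (FinSimple s) x = (s i).1.
Proof.
move=> ps six /=; under eq_bigr do rewrite (partition_term ps six).
by rewrite -big_mkcond big_pred1_eq.
Qed.

Lemma simple_val_InfSimple (s : nat -> R * set X) i x :
  measurable_partition (fun k => (s k).2) -> (s i).2 x ->
  simple_val (InfSimple s) x = (s i).1.
Proof.
move=> ps six /=; apply: lim_near_cst => //; exists i.+1 => // n /= ni.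
rewrite /series/= big_mkord.
under eq_bigr do rewrite (partition_term ps six).
by rewrite -big_mkcond (big_pred1 (Ordinal ni)).
Qed.

Lemma lower_class_FinSimple f n (s : 'I_n -> R * set X) :
  lower_class SP f (FinSimple s) <->
  measurable_partition (fun k => (s k).2) /\ below s f.
Proof.
split=> [[ps sf]|[ps sf]]; split=> //.
  by move=> i x six; rewrite -(simple_val_FinSimple ps six).
move=> x; have [i six] := partition_ex x ps.
by rewrite (simple_val_FinSimple ps six); exact: sf.
Qed.

Lemma lower_class_InfSimple mu f (s : nat -> R * set X) :
  monotone_measure mu ->
  lower_class (SPmu mu) f (InfSimple s) <->
  [/\ measurable_partition (fun k => (s k).2), summable_blocks mu s & below s f].
Proof.
move=> [_ mu0 _].
have sums : measurable_partition (fun k => (s k).2) ->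
    (\sum_(0 <= k <oo) (`|(s k).1| * mu (s k).2)%:E < +oo)%E <->
    summable_blocks mu s.
  move=> [ms _ _]; apply: nneseries_lty_cvgn_series => k.
  by rewrite mulr_ge0// mu0.
split=> [[[fs ps] sf]|[ps cs sf]]; split=> //.
- exact/sums.
- by move=> i x six; rewrite -(simple_val_InfSimple ps six).
- by split => //; exact/sums.
- move=> x; have [i six] := partition_ex x ps.
  by rewrite (simple_val_InfSimple ps six); exact: sf.
Qed.

(** * Passing between finite sequences and infinite ones with eventually empty blocks *)

Definition pad n (s : 'I_n -> R * set X) (k : nat) : R * set X :=
  oapp s (0, set0) (insub k).

Lemma pad_ord n (s : 'I_n -> R * set X) (i : 'I_n) : pad s i = s i.
Proof. by rewrite /pad valK. Qed.

Lemma pad_ge n (s : 'I_n -> R * set X) k : (n <= k)%N -> pad s k = (0, set0).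
Proof. by move=> nk; rewrite /pad insubN// -leqNgt. Qed.

Lemma pad_mem n (s : 'I_n -> R * set X) k x :
  (pad s k).2 x -> exists2 i : 'I_n, k = i & (s i).2 x.
Proof.
have [nk|kn] := leqP n k; first by rewrite pad_ge.
by rewrite -[k]/(nat_of_ord (Ordinal kn)) pad_ord => skx; exists (Ordinal kn).
Qed.

Lemma pad_partition n (s : 'I_n -> R * set X) :
  measurable_partition (fun i => (s i).2) ->
  measurable_partition (fun k => (pad s k).2).
Proof.
move=> ps; have [ms _ _] := ps; split.
- move=> k; have [nk|kn] := leqP n k; first by rewrite pad_ge /=.
  by rewrite -[k]/(nat_of_ord (Ordinal kn)) pad_ord.
- move=> i j _ _ [x [/pad_mem[i' -> si] /pad_mem[j' -> sj]]].
  by rewrite (partition_inj ps si sj).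
- apply/seteqP; split=> // x _; have [i six] := partition_ex x ps.
  by exists i => //; rewrite pad_ord.
Qed.

Lemma pad_below n (s : 'I_n -> R * set X) f : below s f -> below (pad s) f.
Proof.
by move=> sf k x /[dup] /pad_mem[i -> six]; rewrite pad_ord; exact: sf.
Qed.

Lemma truncate_partition (s : nat -> R * set X) m :
  measurable_partition (fun k => (s k).2) ->
  (forall k, (m <= k)%N -> (s k).2 = set0) ->
  measurable_partition (fun i : 'I_m => (s i).2).
Proof.
move=> ps s0; have [ms _ _] := ps; split.
- by move=> i; exact: ms.
- by move=> i j _ _ [x [si sj]]; apply/val_inj/(partition_inj ps si sj).
- apply/seteqP; split=> // x _; have [k skx] := partition_ex x ps.
  have [mk|km] := leqP m k; first by move: skx; rewrite s0.
  by exists (Ordinal km).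
Qed.

Lemma cvgn_series_finite (u : R^nat) m :
  (forall k, (m <= k)%N -> u k = 0) -> series u @ \oo --> \sum_(k < m) u k.
Proof.
move=> u0; apply: cvg_near_cst; exists m => // n /= mn.
rewrite /series/= (big_cat_nat (leq0n m) mn)//= big_mkord [X in _ + X]big_nat.
by rewrite [X in _ + X]big1 ?addr0// => k /andP[mk _]; exact: u0.
Qed.

Lemma basic_sum_truncate mu (s : nat -> R * set X) m : mu set0 = 0 ->
  (forall k, (m <= k)%N -> (s k).2 = set0) ->
  basic_sum mu (FinSimple (fun i : 'I_m => s i)) = basic_sum mu (InfSimple s).
Proof.
move=> mu0 s0 /=; apply/esym/cvg_lim => //.
by apply: cvgn_series_finite => k mk; rewrite s0// mu0 mulr0.
Qed.

Lemma summable_blocks_finite mu (s : nat -> R * set X) m : mu set0 = 0 ->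
  (forall k, (m <= k)%N -> (s k).2 = set0) -> summable_blocks mu s.
Proof.
move=> mu0 s0; apply: cvgP; apply: (@cvgn_series_finite _ m) => k mk.
by rewrite s0// mu0 mulr0.
Qed.

(** * Pasting two simple functions: the first on a set, the second off it *)

Definition patch (s t : nat -> R * set X) E : nat -> R * set X :=
  interleave (fun k => ((s k).1, (s k).2 `&` E))
             (fun k => ((t k).1, (t k).2 `\` E)).

Lemma patch_partition s t E : measurable E ->
  measurable_partition (fun k => (s k).2) ->
  measurable_partition (fun k => (t k).2) ->
  measurable_partition (fun k => (patch s t E k).2).
Proof.
move=> mE ps pt; have [ms _ _] := ps; have [mt _ _] := pt; split.
- move=> k; rewrite /patch /interleave; case: ifP => _ /=.
    exact: measurableD.
  exact: measurableI.
- move=> i j _ _ [x []]; rewrite /patch /interleave => xi xj.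
  (* An index is determined by its parity and its half. Blocks of different parity lie on opposite
     sides of [E]; blocks of equal parity come from the same partition. *)
  suff [oij hij] : odd i = odd j /\ i./2 = j./2.
    by rewrite -[i]odd_double_half oij hij odd_double_half.
  move: xi xj.
  case: ifP => _; case: ifP => _ //=.
  + by move=> [ti _] [tj _]; rewrite (partition_inj pt ti tj).
  + by move=> [_ nE] [_ /nE].
  + by move=> [_ xE] [_ /(_ xE)].
  + by move=> [si _] [sj _]; rewrite (partition_inj ps si sj).
- apply/seteqP; split=> // x _; have [xE|xE] := pselect (E x).
    have [k skx] := partition_ex x ps; exists k.*2 => //.
    by rewrite /patch /interleave odd_double doubleK.
  have [k tkx] := partition_ex x pt; exists k.*2.+1 => //.
  by rewrite /patch /interleave/= odd_double/= uphalf_double.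
Qed.

Lemma patch_below s t E f : below (fun k => ((s k).1, (s k).2 `&` E)) f ->
  below t f -> below (patch s t E) f.
Proof.
move=> sf tf k x; rewrite /patch /interleave; case: ifP => _.
  by move=> [tx _]; exact: tf.
exact: sf.
Qed.

Lemma patch_finite s t E m : (forall k, (m <= k)%N -> (s k).2 = set0) ->
  (forall k, (m <= k)%N -> (t k).2 = set0) ->
  forall k, (m.*2 <= k)%N -> (patch s t E k).2 = set0.
Proof.
move=> s0 t0 k mk; have mk2 : (m <= k./2)%N by rewrite -(doubleK m) half_leq.
by rewrite /patch /interleave; case: ifP => _ /=; rewrite ?t0 ?s0 ?set0I ?set0D.
Qed.

(** * Basic sums of pasted and of lowered simple functions *)

Section Summable.
Context {mu : set X -> R} (mmu : monotone_measure mu).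
Context {s t : nat -> R * set X}.
Context (ps : measurable_partition (fun k => (s k).2)).
Context (pt : measurable_partition (fun k => (t k).2)).
Context (ss : summable_blocks mu s).
Context (st : summable_blocks mu t).

Lemma block_le (a : R) A B : measurable A -> measurable B -> A `<=` B ->
  `|a * mu A| <= `|a| * mu B.
Proof.
move=> mA mB AB; have [_ mu0 muS] := mmu.
by rewrite normrM (ger0_norm (mu0 _ mA)) ler_wpM2l// muS.
Qed.

(** The parameter [h] covers two uses: the norm for summability and [idfun] for the basic sum. *)
Lemma patchM (h : R -> R) E k :
  h (patch s t E k).1 * mu (patch s t E k).2 =
  interleave (fun k => h (s k).1 * mu ((s k).2 `&` E))
             (fun k => h (t k).1 * mu ((t k).2 `\` E)) k.
Proof. by rewrite /patch /interleave; case: ifP. Qed.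

Lemma dominated_setI (h : R -> R) E k : (forall x, `|h x| = `|x|) ->
  measurable E ->
  `|h (s k).1 * mu ((s k).2 `&` E)| <= `|(s k).1| * mu (s k).2.
Proof.
move=> hE mE; have [ms _ _] := ps; rewrite -(hE (s k).1).
by apply: block_le => //; exact: measurableI.
Qed.

Lemma dominated_setD (h : R -> R) E k : (forall x, `|h x| = `|x|) ->
  measurable E ->
  `|h (t k).1 * mu ((t k).2 `\` E)| <= `|(t k).1| * mu (t k).2.
Proof.
move=> hE mE; have [mt _ _] := pt; rewrite -(hE (t k).1).
by apply: block_le => //; exact: measurableD.
Qed.

Lemma patch_summable E : measurable E -> summable_blocks mu (patch s t E).
Proof.
move=> mE; rewrite /summable_blocks; under eq_fun do rewrite patchM.
apply/cvgP/cvgn_series_interleave.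
- apply: dominated_cvgn_series ss => k.
  by apply: dominated_setI => // x; rewrite normr_id.
- apply: dominated_cvgn_series st => k.
  by apply: dominated_setD => // x; rewrite normr_id.
Qed.

Lemma cvg_basic_sum_patch (E : (set X)^nat) :
  continuous_at_empty mu -> continuous_from_below mu ->
  (forall n, measurable (E n)) -> (forall n, E n `<=` E n.+1) ->
  \bigcup_n E n = setT ->
  basic_sum mu (InfSimple (patch s t (E n))) @[n --> \oo] -->
  basic_sum mu (InfSimple s).
Proof.
move=> mu0 mub mE ndE ET /=; have [ms _ _] := ps; have [mt _ _] := pt.
have dI n k := @dominated_setI idfun (E n) k (fun=> erefl) (mE n).
have dD n k := @dominated_setD idfun (E n) k (fun=> erefl) (mE n).
rewrite (_ : (fun n => _) = fun n =>
    limn (series (fun k => (s k).1 * mu ((s k).2 `&` E n))) +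
    limn (series (fun k => (t k).1 * mu ((t k).2 `\` E n)))); last first.
  apply/funext => n; under eq_fun do rewrite (patchM idfun).
  apply/cvg_lim => //; apply: cvgn_series_interleave.
    exact: dominated_cvgn_series (dI n) ss.
  exact: dominated_cvgn_series (dD n) st.
rewrite -[X in _ --> X]addr0; apply: cvgD.
  (* Each block of [s] is the increasing union of its intersections with the [E n], so continuity
     from below applies termwise. *)
  apply: (tannery dI ss) => k; apply: cvgM; first exact: cvg_cst.
  have {2}-> : (s k).2 = \bigcup_n ((s k).2 `&` E n).
    by rewrite -setI_bigcupr ET setIT.
  apply: mub => n; first exact: measurableI.
  exact: setIS.
(* The limit [0] is written as a series of zero terms to match [tannery]. *)
have -> : (0 : R) = limn (series (fun k => (t k).1 * 0)).
  apply/esym/lim_near_cst => //; near=> n.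
  by rewrite /series/= big1// => k _; rewrite mulr0.
apply: (tannery dD st) => k; apply: cvgM; first exact: cvg_cst.
(* The parts of [(t k).2] outside [E n] decrease to the empty set, since the [E n] exhaust the
   space. *)
apply: mu0 => [n|n|]; first exact: measurableD.
  exact: setDS.
apply/seteqP; split=> // x xD; have : [set: X] x by [].
by rewrite -ET => -[n _ Ex]; have [_ /(_ Ex)] := xD n I.
Unshelve. all: by end_near. Qed.

(** The strict inequality lets [fs n] pass [c k] at a finite stage even where [f] equals the value
    of the block and is never attained by [fs n]. Each block receives its own loss, so that
    infinitely many losses still sum to at most [e]. *)
Lemma shrink_blocks (e : R) : 0 < e -> exists c : nat -> R,
  [/\ forall k, c k < (s k).1,
      summable_blocks mu (fun k => (c k, (s k).2)) &
      basic_sum mu (InfSimple s) <=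
      basic_sum mu (InfSimple (fun k => (c k, (s k).2))) + e].
Proof.
move=> e0; have [ms _ _] := ps; have [_ mu0 _] := mmu.
(* The loss [eps k] is chosen so that [eps k * mu (A k) <= e / 2 ^ (k + 1)]. *)
pose h (k : nat) := e / (2 ^ (k + 1))%:R : R.
have h0 k : 0 < h k by rewrite divr_gt0// ltr0n expn_gt0.
have ch : series h @ \oo --> e.
  by have := cvg_geometric_series_half e 0; rewrite expr0 divr1.
pose m k := mu (s k).2; have m0 k : 0 <= m k by exact: mu0.
(* The added [1] keeps the denominator positive on blocks of measure zero. *)
pose eps k := h k / (1 + m k).
have eps0 k : 0 < eps k by rewrite divr_gt0// ltr_pwDl.
have eps_le k : eps k * m k <= h k.
  rewrite /eps mulrAC ler_pdivrMr ?ltr_pwDl// ler_wpM2l ?(ltW (h0 _))//.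
  by rewrite lerDr.
have cs : cvgn (series (fun k => (s k).1 * m k)).
  by apply: dominated_cvgn_series ss => k; exact: block_le.
have cH : summable_blocks mu (fun k => ((s k).1 - eps k, (s k).2)).
  apply: (@dominated_cvgn_series _ _ (fun k => `|(s k).1| * m k + h k)).
    move=> k /=; rewrite normrM normr_id (ger0_norm (m0 k)).
    apply: le_trans (_ : (`|(s k).1| + eps k) * m k <= _).
      by rewrite ler_wpM2r// (le_trans (ler_normB _ _))// (gtr0_norm (eps0 k)).
    by rewrite mulrDl lerD2l.
  by apply: is_cvg_seriesD => //; exact: cvgP ch.
exists (fun k => (s k).1 - eps k); split => //.
  by move=> k; rewrite ltrBlDr ltrDl.
have cc : cvgn (series (fun k => ((s k).1 - eps k) * m k)).
  by apply: dominated_cvgn_series cH => k /=; apply: block_le.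
(* With [e] written as the sum of [h], the inequality can be checked term by term. *)
rewrite /= -(cvg_lim _ ch)// -lim_seriesD//; last exact: cvgP ch.
apply: lim_series_le => //; first by apply: is_cvg_seriesD => //; exact: cvgP ch.
by move=> k; rewrite !fctE /= mulrBl -addrA lerDl addrC subr_ge0.
Qed.

End Summable.

(** Stated for infinite sequences so as to serve both classes. The last conclusion keeps track of
    finiteness: if [s] and [t] are padded finite sequences, [u] can be truncated again. *)
Lemma approx_minorant mu (fs : nat -> X -> R) f (s t : nat -> R * set X)
    (e : R) :
  monotone_measure mu -> continuous_at_empty mu -> continuous_from_below mu ->
  (forall n, measurable_fun setT (fs n)) ->
  (forall n x, fs n x <= fs n.+1 x) ->
  (forall x, fs n x @[n --> \oo] --> f x) ->
  measurable_partition (fun k => (s k).2) -> summable_blocks mu s ->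
  measurable_partition (fun k => (t k).2) -> summable_blocks mu t ->
  below s f -> below t (fs 0%N) -> 0 < e ->
  exists n (u : nat -> R * set X),
  [/\ [/\ measurable_partition (fun k => (u k).2), summable_blocks mu u &
          below u (fs n)],
      basic_sum mu (InfSimple s) <= basic_sum mu (InfSimple u) + e &
      forall m, (forall k, (m <= k)%N -> (s k).2 = set0) ->
        (forall k, (m <= k)%N -> (t k).2 = set0) ->
        forall k, (m.*2 <= k)%N -> (u k).2 = set0].
Proof.
move=> mmu mu0 mub mfs ndfs fsf ps ss pt st sf tf e0.
have e2 : 0 < e / 2 by rewrite divr_gt0.
have [c [cs sc sle]] := shrink_blocks mmu ps ss e2.
pose s' k := (c k, (s k).2).
(* The set where the lowered function is at most [fs n], written as a countable union over blocks to
   make it measurable. *)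
pose E n := \bigcup_k ((s k).2 `&` [set x | c k <= fs n x]).
have [ms _ _] := ps.
have mE n : measurable (E n).
  apply: bigcup_measurable => k _; apply: measurableI => //.
  rewrite (_ : [set x | _] = setT `&` fs n @^-1` `[c k, +oo[); last first.
    by apply/seteqP; split=> x /=; rewrite in_itv/= andbT => // -[].
  exact: mfs.
have ndE n : E n `<=` E n.+1.
  move=> x [k _ [skx /= ck]]; exists k => //; split=> //=.
  exact: le_trans (ndfs _ _).
have ET : \bigcup_n E n = setT.
  apply/seteqP; split=> // x _; have [k skx] := partition_ex x ps.
  (* Since [c k < (s k).1 <= f x], the values [fs n x] eventually exceed [c k]. *)
  have /cvgr_gt/(_ (c k) (lt_le_trans (cs k) (sf _ _ skx)))[n _ cn] := fsf x.
  by exists n => //; exists k => //; split=> //=; apply/ltW/cn => /=.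
have fs0 n x : fs 0%N x <= fs n x.
  by elim: n => // n IHn; exact: le_trans (ndfs _ _).
(* Pasting costs less than [e / 2] for some [n]; lowering has cost at most the other [e / 2]. *)
have /cvgr_gt/(_ (basic_sum mu (InfSimple s') - e / 2)) :=
  @cvg_basic_sum_patch mu mmu s' t ps pt sc st E mu0 mub mE ndE ET.
rewrite ltrBlDr ltrDl => /(_ e2)[n _ /(_ n (leqnn n))/= sn].
exists n, (patch s' t (E n)); split.
- split; first exact: patch_partition.
    exact: patch_summable.
  (* By disjointness, the block through which [x] lies in [E n] is the block [k] containing it. *)
  apply: patch_below => [k x /= [skx [j _ [sjx cj]]]|k x tkx].
    by rewrite (partition_inj ps skx sjx).
  by apply: le_trans (fs0 n x); exact: tf.
- by move: sle sn; rewrite /s' /=; lra.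
- by move=> m s0 t0; exact: patch_finite.
Qed.

(** * Monotonicity and convergence of the lower integrals *)

Lemma lower_integral_mono S mu f g : (forall x, f x <= g x) ->
  (lower_integral S mu f <= lower_integral S mu g)%E.
Proof.
move=> fg; apply: le_ereal_sup => _ [phi [Sphi phif] <-]; exists phi => //.
by split=> // x; exact: le_trans (fg x).
Qed.

End Partitions.

Theorem theorem11 (R : realType) (d : measure_display) (X : measurableType d)
    (mu : set X -> R) (fs : nat -> X -> R) (f : X -> R) (S : set (simple R X)) :
  monotone_measure mu ->
  continuous_at_empty mu ->
  continuous_from_below mu ->
  (forall n, measurable_fun setT (fs n)) ->
  (forall n x, fs n x <= fs n.+1 x) ->
  (forall x, fs n x @[n --> \oo] --> f x) ->
  S = SP \/ S = SPmu mu ->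
  (-oo < lower_integral S mu (fs 0%N))%E ->
  (lower_integral S mu \1_[set: X] < +oo)%E ->
  lower_integral S mu (fs n) @[n --> \oo] --> lower_integral S mu f.
Proof.
(* A lower integral above [-oo] provides a lower simple function [psi] of [fs 0], to be used off the
   sets [E n]. *)
move=> mmu mu0 mub mfs ndfs fsf SE /ereal_sup_gt[_ [psi Spsi _] _] _.
have ndI : nondecreasing_seq (fun n => lower_integral S mu (fs n)).
  by apply/nondecreasing_seqP => n; exact/lower_integral_mono/ndfs.
have fsn_le n x : fs n x <= f x.
  rewrite -(cvg_lim _ (fsf x))//; apply: nondecreasing_cvgn_le; last exact: cvgP.
  by apply/nondecreasing_seqP => k; exact: ndfs.
(* The integrals increase with [n] and so converge to their supremum, which remains to be
   identified. *)
suff -> : lower_integral S mu f =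
    ereal_sup (range (fun n => lower_integral S mu (fs n))).
  exact: ereal_nondecreasing_cvgn.
apply/eqP; rewrite eq_le; apply/andP; split; last first.
  by apply: ge_ereal_sup => _ [n _ <-]; exact: lower_integral_mono.
apply: ge_ereal_sup => _ [phi Sphi <-]; apply/lee_addgt0Pr => e e0.
have suff_minorant n u : lower_class S (fs n) u ->
    basic_sum mu phi <= basic_sum mu u + e ->
    ((basic_sum mu phi)%:E <=
     ereal_sup (range (fun n => lower_integral S mu (fs n))) + e%:E)%E.
  move=> Su phiu; apply: le_trans (_ : (basic_sum mu u)%:E + e%:E <= _)%E.
    by rewrite -EFinD lee_fin.
  rewrite leeD2r//; apply: le_trans (ereal_sup_ubound _); last by exists n.
  by apply: ereal_sup_ubound; exists u.
have [mu00 _ _] := mmu.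
case: SE => SE; rewrite SE in Spsi Sphi.
(* Finite class: pad both sequences, approximate, and truncate the result. *)
- case: psi Spsi => [j t|t [[]]] /lower_class_FinSimple[pt tf].
  case: phi Sphi suff_minorant => [i s|s [[]]] /lower_class_FinSimple[ps sf].
  move=> suff_minorant.
  have s0 k : (i <= k)%N -> (pad s k).2 = set0 by move=> ik; rewrite pad_ge.
  have t0 k : (j <= k)%N -> (pad t k).2 = set0 by move=> jk; rewrite pad_ge.
  have [n [u [[pu su uf] su_le u0]]] := approx_minorant mmu mu0 mub mfs ndfs fsf
    (pad_partition ps) (summable_blocks_finite mu00 s0)
    (pad_partition pt) (summable_blocks_finite mu00 t0)
    (pad_below sf) (pad_below tf) e0.
  (* Both padded sequences have empty blocks from [maxn i j] on; interleaving doubles this bound. *)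
  have {}u0 k : ((maxn i j).*2 <= k)%N -> (u k).2 = set0.
    apply: u0 => l; rewrite geq_max => /andP[il jl]; first exact: s0.
    exact: t0.
  apply: (suff_minorant n (FinSimple (fun i : 'I_(maxn i j).*2 => u i))).
    rewrite SE; apply/lower_class_FinSimple; split; first exact: truncate_partition.
    by move=> k x; exact: uf.
  rewrite (basic_sum_truncate mu00 u0) (le_trans _ su_le)//.
  rewrite -(basic_sum_truncate mu00 s0) /=.
  by under [leRHS]eq_bigr do rewrite pad_ord.
(* Infinite class: the approximating sequence is already of the required form. *)
- case: psi Spsi => [j t [[]]|t] /(lower_class_InfSimple _ _ mmu)[pt st tf].
  case: phi Sphi suff_minorant => [i s [[]]|s].
  move=> /(lower_class_InfSimple _ _ mmu)[ps ss sf] suff_minorant.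
  have [n [u [cu su_le _]]] := approx_minorant mmu mu0 mub mfs ndfs fsf
    ps ss pt st sf tf e0.
  apply: (suff_minorant n (InfSimple u)) => //; rewrite SE.
  exact/lower_class_InfSimple.
Qed.
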